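(* Let $R$ be an associative ring with identity and let $C$ be a $\Sigma$-self-orthogonal left $R$-module. The following assertions hold: 1. $\mathrm{l.Add}(C)\text{-}\mathrm{gl.dim}(\sigma[C])=0$ if and only if $C$ is a semisimple module. 2. $\mathrm{l.Add}(C)\text{-}\mathrm{gl.dim}(\sigma[C])\leq 1$ if and only if $\mathrm{Add}(C)$ is closed under submodules.
   Context: Modules are unitary left $R$-modules. $C$ is $\Sigma$-self-orthogonal if $\mathrm{Ext}_R^{i}(C,C^{(I)})=0$ for every $i\geq 1$ and every set $I$. $\mathrm{Add}(C)=\mathrm{Add}_R(C)$ is the class of all $R$-modules isomorphic to direct summands of direct sums of copies of $C$. A module $N$ is $C$-generated if there is an exact sequence $0\to K\to C^{(\Lambda)}\to N\to 0$ for some set $\Lambda$. $\sigma[C]$ is the full subcategory of $R$-modules whose objects are (isomorphic to) submodules of $C$-generated modules. For a full subcategory $\mathcal{Z}$ of $R$-modules containing $\mathrm{Add}(C)$, $\mathrm{l.Add}(C)\text{-}\mathrm{gl.dim}(\mathcal{Z})$ is the supremum, over all $M\in\mathcal{Z}$, of the exact left $\mathrm{Add}(C)$-dimension of $M$, i.e. the least integer $m\geq 0$ for which there is an exact sequence of $R$-modules $0\to A_m\to\cdots\to A_0\to M\to 0$ with all $A_i\in\mathrm{Add}(C)$ ($\infty$ if there is none). *)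

(* Defs.v *)
From HB Require Import structures.
From mathcomp Require Import all_boot all_order all_algebra.
From mathcomp Require Import finmap all_classical.

Set Implicit Arguments.
Unset Strict Implicit.
Unset Printing Implicit Defensive.

Import GRing.Theory.

Local Open Scope classical_set_scope.
Local Open Scope ring_scope.

(* Left modules over an arbitrary ring are [lmodType R] with [R : pzRingType]
   (the zero ring is allowed). The [choiceType] structure that [lmodType]
   includes is no restriction, since every type has one classically. *)

Record dsum (R : pzRingType) (I : Type) (V : I -> lmodType R) := DSum {
  dsum_val :> forall i, V i;
  dsum_supp : finite_set [set i | dsum_val i != 0]
}.

Section DirectSum.
Variables (R : pzRingType) (I : Type) (V : I -> lmodType R).
Implicit Types (x y z : dsum V) (a b : R).

HB.instance Definition _ := gen_eqMixin (dsum V).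
HB.instance Definition _ := gen_choiceMixin (dsum V).

Lemma dsumP x y : (forall i, x i = y i) -> x = y.
Proof.
case: x y => [f ff] [g fg] /= fg_eq.
have {}fg_eq : f = g by apply: functional_extensionality_dep.
by subst g; rewrite (Prop_irrelevance ff fg).
Qed.

Fact dsum0_supp : finite_set [set i | (0 : V i) != 0].
Proof. by apply: (sub_finite_set _ (@finite_set0 I)) => i /=; rewrite eqxx. Qed.

Fact dsumN_supp x : finite_set [set i | - x i != 0].
Proof. by apply: (sub_finite_set _ (dsum_supp x)) => i /=; rewrite oppr_eq0. Qed.

Fact dsumD_supp x y : finite_set [set i | x i + y i != 0].
Proof.
apply: (@sub_finite_set _ _ ([set i | x i != 0] `|` [set i | y i != 0])).
  move=> i /= xy0; have [x0|] := eqVneq (x i) 0; last by left.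
  by right; rewrite x0 add0r in xy0.
by rewrite finite_setU; split; apply: dsum_supp.
Qed.

Fact dsumZ_supp a x : finite_set [set i | a *: x i != 0].
Proof.
apply: (sub_finite_set _ (dsum_supp x)) => i /=.
by apply: contra_neq => ->; rewrite scaler0.
Qed.

Let add x y := DSum (dsumD_supp x y).
Let opp x := DSum (dsumN_supp x).
Let scale a x := DSum (dsumZ_supp a x).

Fact dsum_addA : associative add.
Proof. by move=> x y z; apply: dsumP => i /=; rewrite addrA. Qed.
Fact dsum_addC : commutative add.
Proof. by move=> x y; apply: dsumP => i /=; rewrite addrC. Qed.
Fact dsum_add0 : left_id (DSum dsum0_supp) add.
Proof. by move=> x; apply: dsumP => i /=; rewrite add0r. Qed.
Fact dsum_addN : left_inverse (DSum dsum0_supp) opp add.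
Proof. by move=> x; apply: dsumP => i /=; rewrite addNr. Qed.

HB.instance Definition _ :=
  GRing.isZmodule.Build (dsum V) dsum_addA dsum_addC dsum_add0 dsum_addN.

Fact dsum_scaleA a b x : scale a (scale b x) = scale (a * b) x.
Proof. by apply: dsumP => i /=; rewrite scalerA. Qed.
Fact dsum_scale1 : left_id 1 scale.
Proof. by move=> x; apply: dsumP => i /=; rewrite scale1r. Qed.
Fact dsum_scaleDr : right_distributive scale +%R.
Proof. by move=> a x y; apply: dsumP => i /=; rewrite scalerDr. Qed.
Fact dsum_scaleDl x : {morph scale^~ x : a b / a + b}.
Proof. by move=> a b; apply: dsumP => i /=; rewrite scalerDl. Qed.

HB.instance Definition _ := GRing.Zmodule_isLmodule.Build R (dsum V)
  dsum_scaleA dsum_scale1 dsum_scaleDr dsum_scaleDl.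

End DirectSum.

(* [copower C I] is C^(I). *)
Definition copower (R : pzRingType) (C : lmodType R) (I : Type) : lmodType R :=
  dsum (fun _ : I => C).

Section Kernel.
Variables (R : pzRingType) (M N : lmodType R) (f : {linear M -> N}).

Definition ker_pred : {pred M} := fun x => f x == 0.

Fact ker_submod : submod_closed ker_pred.
Proof.
split=> [|a x y]; rewrite !unfold_in ?linear0 // => /eqP fx /eqP fy.
by rewrite linearP fx fy scaler0 addr0.
Qed.

HB.instance Definition _ := GRing.isSubmodClosed.Build R M ker_pred ker_submod.

Record kernel := Kernel { ker_val : M; _ : ker_val \in ker_pred }.

HB.instance Definition _ := [isSub for ker_val].
HB.instance Definition _ := [Choice of kernel by <:].
HB.instance Definition _ := [SubChoice_isSubZmodule of kernel by <:].
HB.instance Definition _ := [SubZmodule_isSubLmodule of kernel by <:].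

End Kernel.

Section FreeResolution.
Variable R : pzRingType.

Definition free_module (M : lmodType R) : lmodType R :=
  copower (R^o : lmodType R) M.

(* The sum ranges over the finite support of x. *)
Definition free_cover (M : lmodType R) (x : free_module M) : M :=
  \sum_(m \in [set: M]) ((x : dsum _) m : R) *: m.

Fact free_cover_linear (M : lmodType R) : linear (@free_cover M).
Proof.
move=> a x y; rewrite /free_cover.
have fsupp (z : free_module M) :
    finite_set [set m | (z : dsum (fun _ : M => R^o)) m != 0] by apply: dsum_supp.
have /finite_fsetP[A hA] : finite_set ([set m | (x : dsum _) m != 0] `|`
    [set m | (y : dsum (fun _ : M => R^o)) m != 0]).
  by rewrite finite_setU; split; apply: fsupp.
have nA (m : M) : m \notin A -> (x : dsum _) m = 0 /\ (y : dsum _) m = 0.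
  move=> mA; split; apply: contraNeq mA => nz.
    by have : [set` A] m by rewrite -hA; left.
  by have : [set` A] m by rewrite -hA; right.
rewrite (fsbigTE A); last first.
  by move=> m /nA[xm ym]; rewrite /= xm ym scaler0 addr0 scale0r.
rewrite (fsbigTE A); last by move=> m /nA[-> _]; rewrite scale0r.
rewrite (fsbigTE A); last by move=> m /nA[_ ->]; rewrite scale0r.
rewrite scaler_sumr -big_split /=; apply: eq_bigr => m _.
by rewrite scalerDl scalerA.
Qed.

HB.instance Definition _ (M : lmodType R) := GRing.isLinear.Build R
  (free_module M) M _ (@free_cover M) (@free_cover_linear M).

(* Standard free resolution of M: free_res M n = R^(syzygy M n) covers
   syzygy M n, and syzygy M n.+1 is the kernel of this cover. *)
Fixpoint syzygy (M : lmodType R) (n : nat) : lmodType R :=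
  if n is m.+1 then kernel (@free_cover (syzygy M m)) else M.

Definition free_res (M : lmodType R) (n : nat) : lmodType R :=
  free_module (syzygy M n).

Definition free_res_diff (M : lmodType R) (n : nat)
    (x : free_res M n.+1) : free_res M n :=
  ker_val (free_cover x : kernel (@free_cover (syzygy M n))).

(* Ext^i_R(M, N) = 0: in degree i, every cocycle of the complex
   Hom_R(free_res M, N) is a coboundary. *)
Definition Ext_zero (i : nat) (M N : lmodType R) : Prop :=
  forall f : {linear free_res M i -> N},
    (forall x, f (free_res_diff x) = 0) ->
  match i return (free_res M i -> N) -> Prop with
  | 0 => fun f => forall x, f x = 0
  | j.+1 => fun f =>
      exists g : {linear free_res M j -> N}, forall x, f x = g (free_res_diff x)
  end f.

End FreeResolution.

Definition exact_at (R : pzRingType) (L M N : lmodType R)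
    (f : L -> M) (g : M -> N) : Prop :=
  forall y, g y = 0 <-> exists x, f x = y.

Definition lmod_iso (R : pzRingType) (M N : lmodType R) : Prop :=
  exists f : {linear M -> N}, bijective f.

Definition simple_module (R : pzRingType) (M : lmodType R) : Prop :=
  (exists x : M, x != 0) /\
  forall A : {pred M}, submod_closed A ->
    (forall x, x \in A -> x = 0) \/ (forall x, x \in A).

Definition semisimple_module (R : pzRingType) (M : lmodType R) : Prop :=
  exists (I : Type) (S : I -> lmodType R),
    (forall i, simple_module (S i)) /\ lmod_iso M (dsum S).

(* Extended naturals: None stands for infinity. *)
Definition le_enat (x y : option nat) : bool :=
  match x, y with
  | _, None => true
  | None, Some _ => false
  | Some m, Some n => (m <= n)%N
  end.

(* The least n such that P n, and infinity if there is none. *)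
Definition least (P : nat -> Prop) : option nat :=
  match pselect (exists n, `[< P n >]) with
  | left exP => Some (ex_minn exP)
  | right _ => None
  end.

Section AddC.
Variables (R : pzRingType) (C : lmodType R).

Definition Sigma_self_orthogonal : Prop :=
  forall i, (1 <= i)%N -> forall I : Type, Ext_zero i C (copower C I).

(* M is isomorphic to a direct summand of a module D
   iff M (+) N is isomorphic to D for some N. *)
Definition in_Add (M : lmodType R) : Prop :=
  exists (I : Type) (N : lmodType R),
    lmod_iso ((M * N)%type : lmodType R) (copower C I).

Definition generated (N : lmodType R) : Prop :=
  exists (L : Type) (K : lmodType R)
    (f : {linear K -> copower C L}) (g : {linear copower C L -> N}),
    [/\ injective f, exact_at f g & forall y, exists x, g x = y].

(* Up to isomorphism, a submodule is the source of an injective linear map. *)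
Definition in_sigma (M : lmodType R) : Prop :=
  exists2 N : lmodType R, generated N &
    exists f : {linear M -> N}, injective f.

Definition Add_closed_under_submodules : Prop :=
  forall A N : lmodType R, in_Add A ->
    (exists f : {linear N -> A}, injective f) -> in_Add N.

(* An exact sequence 0 -> A_m -> ... -> A_0 -> M -> 0 with all A_i in Add(C);
   it is indexed by nat, with A_i = 0 for i > m. *)
Definition left_Add_res (m : nat) (M : lmodType R) : Prop :=
  exists (A : nat -> lmodType R) (d : forall i, {linear A i.+1 -> A i})
    (e : {linear A 0%N -> M}),
    [/\ forall i, (i <= m)%N -> in_Add (A i),
        forall i, (m < i)%N -> forall x : A i, x = 0,
        forall i, exact_at (d i.+1) (d i),
        exact_at (d 0%N) e &
        forall y, exists x, e x = y].

Definition lAdd_dim (M : lmodType R) : option nat :=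
  least (fun m => left_Add_res m M).

(* The supremum in the extended naturals is the least upper bound. *)
Definition lAdd_gldim (Z : lmodType R -> Prop) : option nat :=
  least (fun n => forall M, Z M -> le_enat (lAdd_dim M) (Some n)).

End AddC.

(* Main.v *)
Require Import Defs.
From HB Require Import structures.
From mathcomp Require Import all_boot all_order all_algebra.
From mathcomp Require Import ring_quotient finmap all_classical.

(* For 2, let C be Sigma-self-orthogonal. If Add(C) is closed under submodules,
   a module M <= N in sigma[C] is covered by the preimage of M under a cover
   C^(L) -> N, and both this preimage and the kernel lie in Add(C). Conversely,
   let N <= D = C^(I), with a resolution 0 -> A1 -> A0 -> D/N -> 0. Since
   Ext^1(D, A1) = 0, the projection D -> D/N lifts to h : D -> A0; since N also
   has a resolution of length at most 1 and Ext^1, Ext^2 of C into Add(C)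
   vanish, Ext^1(A0, N) = 0 and A0 -> D/N lifts to t : A0 -> D. Then
   (a, d) |-> d - t (a + h d) makes N a retract of A1 (+) D.
   For 1, dimension 0 means sigma[C] = Add(C); then every 0 -> K -> C -> C/K -> 0
   splits because Ext^1(C/K, K) = 0. *)

Set Implicit Arguments.
Unset Strict Implicit.
Unset Printing Implicit Defensive.

Import GRing.Theory.
Import Quotient.

Local Open Scope classical_set_scope.
Local Open Scope quotient_scope.
Local Open Scope ring_scope.

(** * Linear maps and quotients *)

Section LinearMaps.
Variable R : pzRingType.
Implicit Types M N P : lmodType R.

Lemma linear_bundle M N (f : M -> N) :
  linear f -> exists g : {linear M -> N}, g =1 f.
Proof.
move=> lf; pose lfM := GRing.isLinear.Build R M N *:%R f lf.
pose g : {linear M -> N} := HB.pack f lfM.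
by exists g.
Qed.

Lemma linear_sub_val M N P (i : {linear N -> P}) (h : M -> N) (k : M -> P) :
  injective i -> linear k -> (forall x, i (h x) = k x) -> linear h.
Proof.
by move=> inj_i lk hE a x y; apply: inj_i; rewrite linearP !hE lk.
Qed.

Lemma linear_factor_inj M N P (i : {linear N -> M}) (h : {linear P -> M}) :
    injective i -> (forall x, exists y, i y = h x) ->
  exists k : {linear P -> N}, forall x, i (k x) = h x.
Proof.
move=> inj_i /choice[k kE].
have [|l lE] := @linear_bundle P N k; last by exists l => x; rewrite lE.
apply: linear_sub_val kE => //; exact: linearP.
Qed.

Lemma linear_factor_surj M N P (g : {linear M -> N}) (h : {linear M -> P}) :
    (forall y, exists x, g x = y) -> (forall x, g x = 0 -> h x = 0) ->
  exists k : {linear N -> P}, forall x, k (g x) = h x.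
Proof.
move=> /choice[s sE] kerP.
have hsE x : h (s (g x)) = h x.
  by apply/eqP; rewrite -subr_eq0 -linearB kerP // linearB /= sE subrr.
have [|l lE] := @linear_bundle N P (h \o s); last by exists l => x; rewrite lE /= hsE.
move=> a x y /=; rewrite -linearP /=.
by rewrite -[RHS]hsE linearP /= !sE.
Qed.

(** [quot] supplies the additive group; the action of [R] is defined on representatives and is well
    defined because [K] is stable under scalars. *)
Lemma quotient_exists M (K : set M) :
    K 0 -> (forall a x y, K x -> K y -> K (a *: x + y)) ->
  exists (Q : lmodType R) (q : {linear M -> Q}),
    (forall y, exists x, q x = y) /\ (forall x, q x = 0 <-> K x).
Proof.
move=> K0 KP; pose kp : {pred M} := fun x => `[< K x >].
have kpP : submod_closed kp.
  split=> [|a x y]; rewrite !unfold_in; first exact/asboolP.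
  by move=> /asboolP Kx /asboolP Ky; apply/asboolP/KP.
pose kpM := GRing.isZmodClosed.Build M kp (GRing.submod_closedB kpP).
pose I : zmodClosed M := HB.pack kp kpM.
have IP x : reflect (K x) (x \in I) by exact: asboolP.
pose Q := (quot I : zmodType).
have piS (x : Q) : exists y, \pi_Q y = x by exists (repr x); rewrite reprK.
have [sc scE] : exists sc : R -> Q -> Q, forall a x, sc a (\pi_Q x) = \pi_Q (a *: x).
  exists (fun a (x : Q) => \pi_Q (a *: repr x)) => a x.
  apply/eqP; rewrite -idealrBE -scalerBr.
  have /IP Kx : repr (\pi_Q x) - x \in I by rewrite idealrBE reprK.
  by apply/IP; rewrite -[_ *: _]addr0; apply: KP.
have sA a b x : sc a (sc b x) = sc (a * b) x.
  by have [y <-] := piS x; rewrite !scE scalerA.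
have s1 x : sc 1 x = x by have [y <-] := piS x; rewrite scE scale1r.
have sDr : right_distributive sc +%R.
  move=> a x y; have [[x' <-] [y' <-]] := (piS x, piS y).
  by rewrite -raddfD !scE -raddfD scalerDr.
have sDl x : {morph sc^~ x : a b / a + b}.
  by move=> a b; have [y <-] := piS x; rewrite !scE -raddfD scalerDl.
pose QM := GRing.Zmodule_isLmodule.Build R Q sA s1 sDr sDl.
pose Q' : lmodType R := HB.pack Q QM.
have pl : linear (fun x : M => \pi_Q x : Q').
  move=> a x y; rewrite raddfD; congr (_ + _); exact: esym (scE _ _).
have [q qE] := linear_bundle pl.
exists Q', q; split=> [y|x]; first by exists (repr (y : Q)); rewrite qE reprK.
rewrite qE; split=> [/eqP|Kx].
  rewrite -[0 : Q'](raddf0 (\pi_Q : {additive M -> Q})).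
  by rewrite -[_ == _]idealrBE subr0 => /IP.
apply/eqP; rewrite -[0 : Q'](raddf0 (\pi_Q : {additive M -> Q})).
by rewrite -[_ == _]idealrBE subr0; apply/IP.
Qed.

End LinearMaps.

Section KernelInclusion.
Variables (R : pzRingType) (M N : lmodType R) (f : {linear M -> N}).

Fact ker_val_linear : linear (@ker_val R M N f).
Proof. by []. Qed.

HB.instance Definition _ := GRing.isLinear.Build R
  (kernel f) M _ (@ker_val R M N f) ker_val_linear.

Lemma ker_valP (x : kernel f) : f (ker_val x) = 0.
Proof. by case: x => x /= /eqP. Qed.

Lemma ker_val_inj : injective (@ker_val R M N f).
Proof. exact: val_inj. Qed.

Lemma kernel_lift x : f x = 0 -> exists y : kernel f, ker_val y = x.
Proof. by move/eqP=> fx; exists (Kernel fx). Qed.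

End KernelInclusion.

(** * Direct sums *)

Section DirectSumTheory.
Variables (R : pzRingType) (I : Type) (V : I -> lmodType R).

(** Equality of indices is decided classically and [v] is transported along the proof found; proof
    irrelevance makes the value independent of that proof. *)
Definition dsum_inj_fun i (v : V i) (j : I) : V j :=
  if pselect (i = j) is left e then eq_rect i (fun k => V k : Type) v j e else 0.

Lemma dsum_inj_fun_same i (v : V i) : dsum_inj_fun v i = v.
Proof.
rewrite /dsum_inj_fun; case: pselect => // e.
by rewrite (Prop_irrelevance e erefl).
Qed.

Lemma dsum_inj_fun_diff i j (v : V i) : i <> j -> dsum_inj_fun v j = 0.
Proof. by rewrite /dsum_inj_fun; case: pselect. Qed.

Fact dsum_inj_supp i (v : V i) : finite_set [set j | dsum_inj_fun v j != 0].
Proof.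
apply: (sub_finite_set _ (finite_set1 i)) => j /= nz.
by apply: contra_neqP nz => /nesym; exact: dsum_inj_fun_diff.
Qed.

Definition dsum_inj i (v : V i) : dsum V := DSum (dsum_inj_supp v).

Fact dsum_inj_linear i : linear (@dsum_inj i).
Proof.
move=> a x y; apply: dsumP => j /=; have [<-|ij] := pselect (i = j).
  by rewrite !dsum_inj_fun_same.
by rewrite !dsum_inj_fun_diff // scaler0 addr0.
Qed.

HB.instance Definition _ i :=
  GRing.isLinear.Build R (V i) (dsum V) _ (@dsum_inj i) (@dsum_inj_linear i).

Lemma dsum_sum_coord (K : Type) (r : seq K) (F : K -> dsum V) i :
  (\sum_(k <- r) F k) i = \sum_(k <- r) F k i.
Proof. by apply: (big_morph (fun x : dsum V => x i)). Qed.

Lemma dsum_fset_supp (x : dsum V) :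
  exists A : {fset {classic I}}, forall i : {classic I}, i \notin A -> x i = 0.
Proof.
have /(@finite_fsetP {classic I})[A AE] := dsum_supp x.
exists A => i; apply: contraNeq => nz.
by have : [set` A] i by rewrite -AE.
Qed.

Lemma dsum_decomp (x : dsum V) :
  exists A : seq I, x = \sum_(i <- A) dsum_inj (x i).
Proof.
have [A nA] := dsum_fset_supp x; exists A; apply: dsumP => i.
rewrite dsum_sum_coord /=.
have [iA|iA] := boolP ((i : {classic I}) \in A).
  rewrite (@big_fsetD1 _ _ _ {classic I} i) //= dsum_inj_fun_same.
  rewrite (@big_seq _ _ _ {classic I}) big1 ?addr0 //.
  move=> j; rewrite in_fsetD1 => /andP[/eqP ji _].
  by rewrite dsum_inj_fun_diff.
rewrite nA // (@big_seq _ _ _ {classic I}) big1 // => j jA.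
rewrite dsum_inj_fun_diff // => ji.
by rewrite -ji jA in iA.
Qed.

Lemma dsum_ind (P : dsum V -> Prop) :
    P 0 -> (forall x y, P x -> P y -> P (x + y)) ->
    (forall i (v : V i), P (dsum_inj v)) ->
  forall x, P x.
Proof.
move=> P0 PD PI x; have [A ->] := dsum_decomp x.
by elim/big_ind: _.
Qed.

Lemma dsum_universal (M : lmodType R) (f : forall i, {linear V i -> M}) :
  exists h : {linear dsum V -> M}, forall i (v : V i), h (dsum_inj v) = f i v.
Proof.
pose g (x : dsum V) : M := \sum_(i \in [set: {classic I}]) f i (x i).
have gE (x : dsum V) (A : {fset {classic I}}) :
    (forall i : {classic I}, i \notin A -> x i = 0) -> g x = \sum_(i <- A) f i (x i).
  by move=> nA; rewrite /g (fsbigTE A) // => i /nA ->; rewrite linear0.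
have [|h hE] := @linear_bundle _ _ _ g.
  move=> a x y; have [[A nA] [B nB]] := (dsum_fset_supp x, dsum_fset_supp y).
  have nAB i : i \notin (A `|` B)%fset -> x i = 0 /\ y i = 0.
    by rewrite in_fsetU negb_or => /andP[/nA -> /nB ->].
  rewrite !(gE _ (A `|` B)%fset) => [|i /nAB[]//|i /nAB[]//|i /nAB[xi yi]].
    by rewrite scaler_sumr -big_split; apply: eq_bigr => i _ /=; rewrite linearP.
  by rewrite /= xi yi scaler0 addr0.
exists h => i v; rewrite hE (gE _ [fset (i : {classic I})]%fset).
  by rewrite big_seq_fset1 /= dsum_inj_fun_same.
by move=> j; rewrite in_fset1 => /eqP ji /=; rewrite dsum_inj_fun_diff // => /esym.
Qed.

End DirectSumTheory.

Section Copower.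
Variables (R : pzRingType) (C : lmodType R) (I : Type).

Definition copower_inj (i : I) : {linear C -> copower C I} :=
  GRing.Linear.clone R C (copower C I) _ (@dsum_inj R I (fun=> C) i) _.

Lemma copower_ind (P : copower C I -> Prop) :
    P 0 -> (forall x y, P x -> P y -> P (x + y)) ->
    (forall i v, P (copower_inj i v)) ->
  forall x, P x.
Proof. exact: dsum_ind. Qed.

Lemma copower_universal (M : lmodType R) (f : I -> {linear C -> M}) :
  exists h : {linear copower C I -> M}, forall i v, h (copower_inj i v) = f i v.
Proof. exact: (@dsum_universal R I (fun=> C) M f). Qed.

End Copower.

(** * Retracts, Add(C) and split modules *)

Section Retracts.
Variable R : pzRingType.
Implicit Types M N D : lmodType R.

Definition retract M D : Prop :=
  exists (i : {linear M -> D}) (r : {linear D -> M}), forall x, r (i x) = x.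

Lemma retract_refl M : retract M M.
Proof. by exists idfun, idfun. Qed.

Lemma retract_trans N M D : retract M N -> retract N D -> retract M D.
Proof.
move=> [i [r ri]] [j [s sj]].
exists (j \o i : {linear M -> D}), (r \o s : {linear D -> M}) => x /=.
by rewrite sj ri.
Qed.

Lemma retract_prod M N M' N' :
  retract M M' -> retract N N' -> retract (M * N)%type (M' * N')%type.
Proof.
move=> [i [r ri]] [j [s sj]].
have [|f fE] := @linear_bundle R (M * N)%type (M' * N')%type (fun x => (i x.1, j x.2)).
  by move=> a x y; rewrite /= !linearP.
have [|g gE] := @linear_bundle R (M' * N')%type (M * N)%type (fun x => (r x.1, s x.2)).
  by move=> a x y; rewrite /= !linearP.
by exists f, g => -[x y]; rewrite fE gE /= ri sj.
Qed.

Lemma iso_retract M D : lmod_iso M D -> retract M D /\ retract D M.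
Proof.
move=> [f [g fK gK]].
have [|h hE] := @linear_bundle _ D M g.
  by apply: (linear_sub_val (can_inj fK) _ gK) => a x y.
by split; [exists f, h | exists h, f] => x; rewrite hE.
Qed.

End Retracts.

Section AddClosure.
Variables (R : pzRingType) (C : lmodType R).
Implicit Types M N : lmodType R.

(** If [r] is a retraction of [i], then [d = i (r d) + (d - i (r d))] splits the copower with
    complement [kernel r]. Membership as a retract composes easily, with no complement to carry
    along. *)
Lemma in_AddP M : in_Add C M <-> exists I : Type, retract M (copower C I).
Proof.
split=> [[I [N /iso_retract[MND _]]]|[I [i [r ri]]]].
  exists I; apply: retract_trans MND.
  have [|f fE] := @linear_bundle R M (M * N)%type (fun x => (x, 0)).
    by move=> a x y; congr (_, _); rewrite /= scaler0 addr0.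
  have [//|g gE] := @linear_bundle R (M * N)%type M fst.
  by exists f, g => x; rewrite gE fE.
exists I, (kernel r).
have [|f fE] := @linear_bundle R (M * kernel r)%type (copower C I)
    (fun x => i x.1 + ker_val x.2).
  by move=> a x y; rewrite /= linearP scalerDr addrACA.
exists f.
have kP d : d - i (r d) \in ker_pred r by rewrite unfold_in linearB /= ri subrr.
exists (fun d => (r d, Kernel (kP d))) => [[m n]|d]; rewrite !fE /=; last first.
  by rewrite addrC subrK.
have rE : r (i m + ker_val n) = m by rewrite linearD /= ri ker_valP addr0.
by congr (_, _) => //; apply: val_inj => /=; rewrite rE addrAC subrr add0r.
Qed.

Lemma in_Add_copower (I : Type) : in_Add C (copower C I).
Proof. by apply/in_AddP; exists I; exact: retract_refl. Qed.

Lemma in_Add_retract M N : retract M N -> in_Add C N -> in_Add C M.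
Proof.
by move=> MN /in_AddP[I NI]; apply/in_AddP; exists I; exact: retract_trans NI.
Qed.

Lemma in_Add_trivial M : (forall x : M, x = 0) -> in_Add C M.
Proof.
by move=> M0; apply/in_AddP; exists void, \0, \0 => x; rewrite [RHS]M0.
Qed.

Lemma copower_sum_retract (I J : Type) :
  retract (copower C I * copower C J)%type (copower C (I + J)).
Proof.
have [f fE] := copower_universal (fun i : I => @copower_inj R C (I + J)%type (inl i)).
have [g gE] := copower_universal (fun j : J => @copower_inj R C (I + J)%type (inr j)).
have [p pE] := copower_universal (fun k : I + J =>
  if k is inl i then copower_inj C i else \0 : {linear C -> copower C I}).
have [q qE] := copower_universal (fun k : I + J =>
  if k is inr j then copower_inj C j else \0 : {linear C -> copower C J}).
have pf x : p (f x) = x.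
  elim/copower_ind: x => [|x y|i v]; rewrite ?linear0 ?linearD /= ?fE ?pE //.
  by move=> -> ->.
have pg x : p (g x) = 0.
  elim/copower_ind: x => [|x y|i v]; rewrite ?linear0 ?linearD /= ?gE ?pE // => -> ->.
  by rewrite addr0.
have qf x : q (f x) = 0.
  elim/copower_ind: x => [|x y|i v]; rewrite ?linear0 ?linearD /= ?fE ?qE // => -> ->.
  by rewrite addr0.
have qg x : q (g x) = x.
  elim/copower_ind: x => [|x y|i v]; rewrite ?linear0 ?linearD /= ?gE ?qE //.
  by move=> -> ->.
have [|h hE] := @linear_bundle R (copower C I * copower C J)%type
    (copower C (I + J)) (fun x => f x.1 + g x.2).
  by move=> a x y; rewrite /= !linearP scalerDr addrACA.
have [|k kE] := @linear_bundle R (copower C (I + J))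
    (copower C I * copower C J)%type (fun x => (p x, q x)).
  by move=> a x y; rewrite /= !linearP.
exists h, k => -[x y]; rewrite hE kE /= !linearD /= pf pg qf qg.
by rewrite addr0 add0r.
Qed.

Lemma in_Add_prod M N : in_Add C M -> in_Add C N -> in_Add C (M * N)%type.
Proof.
move=> /in_AddP[I MI] /in_AddP[J NJ]; apply/in_AddP; exists (I + J)%type.
apply: retract_trans (copower_sum_retract I J); exact: retract_prod.
Qed.

End AddClosure.

Section SplitModules.
Variable R : pzRingType.
Implicit Types M N : lmodType R.

Definition submod M (K : set M) : Prop :=
  K 0 /\ forall a x y, K x -> K y -> K (a *: x + y).

Lemma submodD M (K : set M) x y : submod K -> K x -> K y -> K (x + y).
Proof. by move=> [_ KP] Kx Ky; rewrite -[x]scale1r; apply: KP. Qed.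

Lemma submodZ M (K : set M) a x : submod K -> K x -> K (a *: x).
Proof. by move=> [K0 KP] Kx; rewrite -[_ *: _]addr0; apply: KP. Qed.

Lemma submodB M (K : set M) x y : submod K -> K x -> K y -> K (x - y).
Proof.
by move=> sK Kx Ky; apply: submodD => //; rewrite -scaleN1r; apply: submodZ.
Qed.

Lemma submod_preimage M N (f : {linear M -> N}) (K : set N) :
  submod K -> submod [set x | K (f x)].
Proof.
move=> [K0 KP]; split=> [|a x y]; first by rewrite /= linear0.
by rewrite /= linearP; apply: KP.
Qed.

Lemma submod_range M N (f : {linear M -> N}) : submod [set y | exists x, f x = y].
Proof.
split=> [|a _ _ [x <-] [y <-]]; first by exists 0; rewrite linear0.
by exists (a *: x + y); rewrite linearP.
Qed.

Lemma submod_ker M N (f : {linear M -> N}) : submod [set x | f x = 0].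
Proof.
apply: (submod_preimage f (K := [set y | y = 0])).
by split=> [//|a _ _ -> ->]; rewrite scaler0 addr0.
Qed.

Lemma submod_add M (K L : set M) : submod K -> submod L ->
  submod [set z | exists x y, [/\ K x, L y & z = x + y]].
Proof.
move=> [K0 KP] [L0 LP]; split=> [|a _ _ [x [y [Kx Ly ->]]] [x' [y' [Kx' Ly' ->]]]].
  by exists 0, 0; rewrite addr0.
exists (a *: x + x'), (a *: y + y'); split; [exact: KP|exact: LP|].
by rewrite scalerDr addrACA.
Qed.

(** The complement form of semisimplicity: [p] is a projection onto [K], so [K] is a direct summand
    whose complement is the kernel of [p]. *)
Definition split_module M : Prop := forall K : set M, submod K ->
  exists p : {linear M -> M}, (forall x, K (p x)) /\ (forall x, K x -> p x = x).

(** A projection [p] onto the preimage of [K] fixes the kernel of [g], which lies in that preimage;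
    hence [g \o p] kills this kernel and descends to [N]. *)
Lemma split_quotient M N (g : {linear M -> N}) :
  (forall y, exists x, g x = y) -> split_module M -> split_module N.
Proof.
move=> gS sM K sK.
have [p [pK pid]] := sM _ (submod_preimage g sK).
have [|k kE] := @linear_factor_surj _ _ _ _ g (g \o p : {linear M -> N}) gS.
  by move=> x gx; rewrite /= pid //= gx; case: sK.
exists k; split=> y; have [x <-] := gS y; rewrite kE /=; first exact: pK.
by move=> Kx; rewrite pid.
Qed.

(** With [p] a projection onto the kernel of [g], the map [x |-> x - p x] kills this kernel and
    descends to a section of [g]. *)
Lemma split_quotient_retract M N (g : {linear M -> N}) :
  (forall y, exists x, g x = y) -> split_module M -> retract N M.
Proof.
move=> gS sM; have [p [pK pid]] := sM _ (submod_ker g).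
have [|h hE] := @linear_bundle R M M (fun x => x - p x).
  by move=> a x y; rewrite linearP scalerBr opprD addrACA.
have [|s sE] := @linear_factor_surj _ _ _ _ g h gS.
  by move=> x gx; rewrite hE pid ?subrr.
exists s, g => y; have [x <-] := gS y.
by rewrite sE hE linearB /= pK subr0.
Qed.

Lemma split_sub_retract M N (f : {linear M -> N}) :
  injective f -> split_module N -> retract M N.
Proof.
move=> fI sN; have [p [pf pid]] := sN _ (submod_range f).
have [r rE] := linear_factor_inj fI pf.
exists f, r => x; apply: fI; rewrite rE pid //; by exists x.
Qed.

End SplitModules.

(** * Semisimple modules *)

Section Semisimple.
Variable R : pzRingType.
Implicit Types M N : lmodType R.

Lemma simple_submod M (A : set M) : simple_module M -> submod A ->
  (forall x, A x -> x = 0) \/ (forall x, A x).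
Proof.
move=> [_ sM] [A0 AP]; pose a : {pred M} := fun x => `[< A x >].
have [|a0|aT] := sM a; last by right=> x; apply/asboolP/aT.
  split=> [|c x y]; rewrite !unfold_in; first exact/asboolP.
  by move=> /asboolP Ax /asboolP Ay; apply/asboolP/AP.
by left=> x /asboolP /a0.
Qed.

(** Lets Zorn's lemma handle conditions that involve finitely many elements at a time. The
    alternative [set0] covers the empty chain. *)
Lemma chain_bigcup_seq (T : eqType) (F : set (set T)) (s : seq T) :
    total_on F subset ->
  exists2 X, X = set0 \/ F X &
    forall i, i \in s -> (\bigcup_(Y in F) Y) i -> X i.
Proof.
move=> totF; elim: s => [|j s [X FX sX]]; first by exists set0; [left|].
have [[Y FY Yj]|nFj] := pselect ((\bigcup_(Y in F) Y) j); last first.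
  by exists X => // i; rewrite inE => /orP[/eqP->|/sX].
suff [Z [FZ XZ YZ]] : exists Z, [/\ F Z, X `<=` Z & Y `<=` Z].
  exists Z; first by right.
  by move=> i; rewrite inE => /orP[/eqP-> _|/sX Xi /Xi /XZ//]; apply: YZ.
case: FX => [->|FX]; first by exists Y; split.
by have [XY|YX] := totF X Y FX FY; [exists Y | exists X]; split.
Qed.

Section Complement.
Variables (I : Type) (S : I -> lmodType R).

Definition supported_in (J : set I) : set (dsum S) :=
  [set x | forall i, ~ J i -> x i = 0].

Lemma submod_supported J : submod (supported_in J).
Proof.
split=> [//|a x y xJ yJ i nJ /=]; by rewrite xJ // yJ // scaler0 addr0.
Qed.

(** Take [J] maximal such that the partial sum over [J] meets [K] trivially. If some [S i] were not
    contained in [K] plus this partial sum, it would meet it trivially by simplicity, and [i] could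
    be added to [J]. *)
Lemma simple_dsum_complement (K : set (dsum S)) :
    (forall i, simple_module (S i)) -> submod K ->
  exists J : set I, (forall x, K x -> supported_in J x -> x = 0) /\
    forall x, exists k s, [/\ K k, supported_in J s & x = k + s].
Proof.
move=> simpleS sK.
pose P (J : set I) := forall x, K x -> supported_in J x -> x = 0.
have P0 : P set0 by move=> x _ x0; apply: dsumP => i; rewrite x0.
(* Supports are finite, so an element supported in the union of a chain is already supported in one
   member of it, or is zero. *)
have [F FP totF|J [PJ Jmax]] := @Zorn_bigcup I P.
  move=> x Kx xF; have [A nA] := dsum_fset_supp x.
  have [X FX AX] := @chain_bigcup_seq {classic I} F A totF.
  have PX : P X by case: FX => [->|/FP].
  apply: PX => // i nX; apply: contrapT => xi.
  apply: nX; apply: AX; last by apply: contrapT => /xF.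
  by apply: contra_notT xi => /nA.
exists J; split=> //.
have sL := submod_add sK (submod_supported J).
set L := [set z | _] in sL.
have LK x : K x -> L x by move=> Kx; exists x, 0; rewrite addr0; split.
have LJ x : supported_in J x -> L x.
  by move=> Jx; exists 0, x; rewrite add0r; split=> //; case: sK.
apply: dsum_ind => [|x y|i v]; [by apply: LK; case: sK|exact: (submodD sL)|].
have [Ji|nJi] := pselect (J i).
  by apply: LJ => j nJj /=; rewrite dsum_inj_fun_diff // => ij; rewrite -ij in nJj.
have [x [Kx xJi nx0]] : exists x, [/\ K x, supported_in (J `|` [set i]) x & x <> 0].
  apply: contrapT => nex; apply: (Jmax (J `|` [set i])).
    by split=> [j Jj|JiJ]; [left | apply: nJi; apply: JiJ; right].
  by move=> x Kx xJi; apply: contrapT => nx0; apply: nex; exists x.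
have LA : submod [set w | L (dsum_inj (w : S i))].
  exact: (submod_preimage (@dsum_inj R I S i : {linear S i -> dsum S}) sL).
(* [x] is in [K] and differs from its component at [i] by an element supported in [J]. If that
   component vanished, [x] would contradict the choice of [J]. *)
have xiL : L (dsum_inj (x i)).
  have -> : dsum_inj (x i) = x - (x - dsum_inj (x i)) by rewrite opprB addrC subrK.
  apply: (submodB sL); [exact: LK | apply: LJ => j nJj /=].
  have [<-|ij] := pselect (i = j); first by rewrite dsum_inj_fun_same subrr.
  by rewrite dsum_inj_fun_diff // subr0 xJi // => -[//|/esym].
have [A0|AT] := simple_submod (simpleS i) LA; last exact: AT.
have xi0 : x i = 0 by apply: A0.
case: nx0; apply: PJ => // j nJj; have [<-//|ij] := pselect (i = j).
by apply: xJi => -[//|/esym].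
Qed.

Lemma simple_dsum_split : (forall i, simple_module (S i)) -> split_module (dsum S).
Proof.
move=> simpleS K sK; have [J [KJ0 KJ]] := simple_dsum_complement simpleS sK.
have /choice[k kP] : forall x, exists k, K k /\ supported_in J (x - k).
  by move=> x; have [k [s [Kk Js ->]]] := KJ x; exists k; rewrite addrAC subrr add0r.
have kE x y : K y -> supported_in J (x - y) -> k x = y.
  move=> Ky Jxy; have [Kk Jk] := kP x; apply/eqP; rewrite -subr_eq0; apply/eqP.
  apply: KJ0; first exact: (submodB sK).
  have -> : k x - y = (x - y) - (x - k x) by rewrite opprB [RHS]addrC addrA subrK.
  by apply: (submodB (submod_supported J)).
have [|p pE] := @linear_bundle _ _ _ k.
  move=> a x y; have [[Kx Jx] [Ky Jy]] := (kP x, kP y); apply: kE.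
    by case: sK => _; apply.
  rewrite opprD addrACA -scalerBr.
  by case: (submod_supported J) => _; apply.
exists p; split=> x; rewrite pE; first by case: (kP x).
by move=> Kx; apply: kE; rewrite // subrr; case: (submod_supported J).
Qed.

End Complement.

Lemma lmod_iso_bij M N (f : {linear M -> N}) :
  injective f -> (forall y, exists x, f x = y) -> lmod_iso M N.
Proof.
by move=> fI /choice[g gK]; exists f, g => // x; apply: fI; rewrite gK.
Qed.

Lemma lmod_iso_sym M N : lmod_iso M N -> lmod_iso N M.
Proof.
move=> [f [g fK gK]]; have [|h hE] := @linear_bundle _ N M g.
  by apply: (linear_sub_val (can_inj fK) _ gK) => a x y.
by exists h, f => x; rewrite hE.
Qed.

(* Take [L] maximal among the submodules containing [G] but not [x]: it is a
   proper summand, and every nonzero submodule of a complement of [L] generates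
   together with [L] all of [M], by maximality. *)
Lemma split_simple_complement M (G : set M) (x : M) :
    split_module M -> submod G -> ~ G x ->
  exists q : {linear M -> M}, simple_module (kernel q) /\ (forall y, G y -> q y = y).
Proof.
move=> sM sG nGx.
(* The condition bears on the union of [G] and [A], not on [A] alone, so that it also holds for the
   empty union of an empty chain. *)
pose P (A : set M) := submod (G `|` A) /\ ~ (G `|` A) x.
have [F FP totF|A [[sL nLx] Amax]] := @Zorn_bigcup M P.
  split; last by case=> // -[A FA Ax]; case: (FP _ FA) => _; apply; right.
  split=> [|a y z]; first by left; case: sG.
  have sub X : X = set0 \/ F X -> submod (G `|` X).
    by case=> [->|/FP[]//]; rewrite setU0.
  have FG w X : F X -> (G `|` X) w -> (G `|` \bigcup_(Y in F) Y) w.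
    by move=> FX [Gw|Xw]; [left | right; exists X].
  case=> [Gy|[X FX Xy]]; case=> [Gz|[Y FY Yz]].
  - by left; case: sG => _; apply.
  - by apply: (FG _ Y) => //; case: (FP _ FY) => -[_ ] + _; apply; [left | right].
  - by apply: (FG _ X) => //; case: (FP _ FX) => -[_ ] + _; apply; [right | left].
  have [XY|YX] := totF X Y FX FY.
    by apply: (FG _ Y) => //; case: (FP _ FY) => -[_ ] + _; apply; right => //; apply: XY.
  by apply: (FG _ X) => //; case: (FP _ FX) => -[_ ] + _; apply; right => //; apply: YX.
set L := G `|` A in sL nLx.
have Lmax (N : set M) : submod N -> L `<=` N -> ~ N x -> N `<=` L.
  move=> sN LN nNx; apply: contrapT => nNL; apply: (Amax N).
    split=> [y Ay|NA]; first by apply: LN; right.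
    by apply: nNL => y /NA Ay; right.
  by rewrite /P setUidr // => y Gy; apply: LN; left.
have [q [qL qid]] := sM L sL.
exists q; split=> [|y Gy]; last by apply: qid; left.
have kerL y : q y = 0 -> L y -> y = 0 by move=> <- /qid.
have qP y : y - q y \in ker_pred q by rewrite unfold_in linearB /= (qid (q y)) // subrr.
split.
  exists (Kernel (qP x)); apply/eqP => /(congr1 (@ker_val _ _ _ q)) /= /eqP.
  by rewrite subr_eq0 => /eqP xq; apply: nLx; rewrite xq.
move=> T [T0 TP].
have [Ttriv|nT] := pselect (forall t, t \in T -> t = 0); [by left | right].
have [t [Tt t0]] : exists t, t \in T /\ t <> 0.
  apply: contrapT => nex; apply: nT => t Tt.
  by apply: contrapT => t0; apply: nex; exists t.
pose T' := [set y | exists2 t, t \in T & ker_val t = y].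
have sT' : submod T'.
  split=> [|a _ _ [u Tu <-] [v Tv <-]]; first by exists 0.
  by exists (a *: u + v); first exact: TP.
have sLT := submod_add sL sT'; set LT := [set z | _] in sLT.
have LLT : L `<=` LT by move=> y Ly; exists y, 0; rewrite addr0; split=> //; case: sT'.
have TLT y : T' y -> LT y.
  by move=> Ty; exists 0, y; rewrite add0r; split=> //; case: sL.
(* Otherwise maximality puts [N] inside [L], and the nonzero [u] lies both in [L] and in the kernel
   of the projection onto [L]. *)
have big (N : set M) (u : kernel q) :
    submod N -> L `<=` N -> N (ker_val u) -> u <> 0 -> N x.
  move=> sN LN Nu u0; apply: contrapT => nNx; apply: u0; apply: ker_val_inj.
  by rewrite linear0; apply: kerL; [exact: ker_valP | exact: (Lmax N)].
have LTx : LT x by apply: (big LT t) => //; apply: TLT; exists t.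
have [p [pLT pid]] := sM LT sLT.
have kp := submod_ker p.
(* The kernel of [p] is a complement of [LT]. Added to [L] it still misses [x], because [x] is in
   [LT]; by maximality it is contained in [L], hence in [LT], which forces [LT] to be all of [M]. *)
have p0 y : p y = 0 -> L y.
  move=> py.
  have sLU := submod_add sL kp; set LU := [set z | _] in sLU.
  have LLU : L `<=` LU.
    by move=> z Lz; exists z, 0; rewrite addr0; split=> //; case: kp.
  have nLUx : ~ LU x.
    move=> [l [u [Ll pu xE]]]; apply: nLx.
    have -> // : x = l.
    rewrite xE -[u]pid ?pu ?addr0 //.
    have -> : u = x - l by rewrite xE addrAC subrr add0r.
    by apply: (submodB sLT) => //; apply: LLT.
  apply: (Lmax LU) => //; exists 0, y; rewrite add0r; split=> //; by case: sL.
move=> u.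
have LTu : LT (ker_val u).
  have -> : ker_val u = (ker_val u - p (ker_val u)) + p (ker_val u) by rewrite subrK.
  apply: (submodD sLT) => //; apply: LLT; apply: p0.
  by rewrite linearB /= (pid (p _)) // subrr.
(* The component [l] is a difference of two elements of the kernel of [q], so it is zero and [u] is
   in [T]. *)
have [l [_ [Ll [v Tv <-] uE]]] := LTu.
suff -> : u = v by [].
apply: ker_val_inj; rewrite uE (kerL l) ?add0r //.
have -> : l = ker_val u - ker_val v by rewrite uE addrK.
by rewrite linearB /= !ker_valP subrr.
Qed.

(** The simple kernels of endomorphisms of [M] span [M]: an element outside their sum would yield
    one more such kernel meeting the sum trivially, although it is one of the summands. A partial
    sum complementing the kernel of the sum map [g] is then isomorphic to [M]. *)
Lemma split_semisimple M : split_module M -> semisimple_module M.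
Proof.
move=> sM.
pose I : Type := {q : {linear M -> M} | simple_module (kernel q)}.
pose S (i : I) : lmodType R := kernel (sval i).
have simpleS i : simple_module (S i) by exact: svalP i.
have [g gE] := @dsum_universal R I S M
  (fun i => @ker_val _ _ _ (sval i) : {linear S i -> M}).
have gS y : exists x, g x = y.
  apply: contrapT => ngy.
  have [q [simple_q qG]] := split_simple_complement sM (submod_range g) ngy.
  have [z nz] := simple_q.1.
  have gz : g (@dsum_inj R I S (exist _ q simple_q) z) = ker_val z by rewrite gE.
  have zE : ker_val z = 0.
    by rewrite -(qG (ker_val z)) ?ker_valP //= -gz; eexists.
  by case/eqP: nz; apply: val_inj.
have [J [KJ0 KJ]] := simple_dsum_complement simpleS (submod_ker g).
pose SJ (j : {i | J i}) := S (sval j).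
have [e eE] := @dsum_universal R _ SJ (dsum S)
  (fun j => @dsum_inj R I S (sval j) : {linear S (sval j) -> dsum S}).
have eJ x : supported_in J (e x).
  elim/dsum_ind: x => [|x y Jx Jy|j v]; rewrite ?linear0 ?linearD.
  - by case: (submod_supported S J).
  - by apply: (submodD (submod_supported S J)).
  rewrite eE => i nJi /=; rewrite dsum_inj_fun_diff // => ji.
  by apply: nJi; rewrite -ji; exact: svalP j.
have e_coord x j : e x (sval j) = x j.
  elim/dsum_ind: x => [|x y Jx Jy|k v]; rewrite ?linear0 ?linearD //=.
    by rewrite Jx Jy.
  rewrite eE /=; have [kj|kj] := pselect (k = j).
    by rewrite -kj !dsum_inj_fun_same.
  rewrite !dsum_inj_fun_diff // => kj'; apply: kj.
  by apply: eq_sig_hprop kj' => l; exact: Prop_irrelevance.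
have eS x : supported_in J x -> exists y, e y = x.
  move=> Jx; have [A ->] := dsum_decomp x.
  apply: (big_ind (fun z => exists y, e y = z)) => [|_ _ [y <-] [z <-]|i _].
  - by exists 0; rewrite linear0.
  - by exists (y + z); rewrite linearD.
  have [Ji|nJi] := pselect (J i); last by exists 0; rewrite Jx // !linear0.
  by exists (@dsum_inj _ _ SJ (exist _ i Ji) (x i)); rewrite eE.
exists {i | J i}, SJ; split=> [j|]; first exact: simpleS.
apply: lmod_iso_sym.
apply: (@lmod_iso_bij _ _ (g \o e : {linear dsum SJ -> M})) => [x y /eqP|y].
  rewrite -subr_eq0 -linearB => /eqP /= gxy; apply/eqP; rewrite -subr_eq0; apply/eqP.
  have exy : e (x - y) = 0 by apply: KJ0.
  by apply: dsumP => j; rewrite -e_coord exy.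
have [x <-] := gS y; have [k [s [gk Js ->]]] := KJ x.
have [z zE] := eS s Js; exists z.
by rewrite /= zE linearD /= gk add0r.
Qed.

End Semisimple.

(** * Ext and lifting of maps *)

Section Lifting.
Variable R : pzRingType.
Implicit Types X M N E F : lmodType R.

Lemma free_cover_inj X (x : X) (r : R) :
  free_cover (copower_inj (R^o : lmodType R) x r : free_module X) = r *: x.
Proof.
rewrite /free_cover (fsbigTE [fset x]%fset) => [|m].
  by rewrite big_seq_fset1 /= dsum_inj_fun_same.
rewrite in_fset1 => /eqP mx /=.
by rewrite dsum_inj_fun_diff ?scale0r // => /esym.
Qed.

Lemma free_cover_surj X (x : X) : exists y : free_module X, free_cover y = x.
Proof.
by exists (copower_inj (R^o : lmodType R) x 1); rewrite free_cover_inj scale1r.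
Qed.

Lemma free_module_projective X E F (g : {linear E -> F})
    (h : {linear free_module X -> F}) :
    (forall y, exists x, g x = y) ->
  exists k : {linear free_module X -> E}, forall x, g (k x) = h x.
Proof.
move=> gS.
have /choice[e eE] (x : X) : exists e, g e = h (copower_inj (R^o : lmodType R) x 1).
  exact: gS.
have /choice[f fE] (x : X) :
    exists f : {linear (R^o : lmodType R) -> E}, forall r : R, f r = r *: e x.
  by apply: linear_bundle => a r s; rewrite scalerDl scalerA.
have [k kE] := copower_universal f.
exists k => y; elim/copower_ind: y => [|y z gy gz|x r]; first by rewrite !linear0.
  by rewrite !linearD gy gz.
rewrite kE fE linearZ /= eE -linearZ /=; congr (h _).
by rewrite -linearZ /=; congr (copower_inj _ _ _); rewrite /GRing.scale /= mulr1.
Qed.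

(* Ext^1(X, N) = 0, computed from 0 -> kernel -> free_module X -> X -> 0. *)
Definition Ext1_zero X N : Prop :=
  forall f : {linear kernel (@free_cover R X) -> N},
    exists g : {linear free_module X -> N}, forall z, g (ker_val z) = f z.

(** Composed with the cover of the first syzygy, [f] becomes a cocycle, since the next differential
    lands in the kernel of this cover; surjectivity of the cover brings the coboundary equation back
    to [f]. *)
Lemma Ext_zero_1 X N : Ext_zero 1 X N -> Ext1_zero X N.
Proof.
move=> ext f.
have [|g gE] := ext (f \o @free_cover R (kernel (@free_cover R X)) : {linear _ -> _}).
  by move=> x; rewrite /= /free_res_diff ker_valP linear0.
exists g => z; have [y yz] := free_cover_surj z.
by rewrite -yz; apply: esym; exact: (gE y).
Qed.

Lemma Ext1_zero_retract X N N' : retract N N' -> Ext1_zero X N' -> Ext1_zero X N.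
Proof.
move=> [i [r ri]] ext f; have [g gE] := ext (i \o f : {linear _ -> _}).
by exists (r \o g : {linear _ -> _}) => z; rewrite /= gE /= ri.
Qed.

(** The form of Ext^1(X, N) = 0 that passes to copowers and retracts of [X] without any comparison
    of free resolutions. *)
Definition lifts X N : Prop :=
  forall E F (i : {linear N -> E}) (g : {linear E -> F}),
    injective i -> exact_at i g -> (forall y, exists x, g x = y) ->
  forall h : {linear X -> F}, exists k : {linear X -> E}, forall x, g (k x) = h x.

(** Lift [h] to a map [p] on the free cover of [X]. On the kernel of the cover [p] takes values in
    [N]; subtracting an extension of this restriction leaves a map that descends to [X]. *)
Lemma Ext1_zero_lifts X N : Ext1_zero X N -> lifts X N.
Proof.
move=> ext E F i g iI ig gS h.
have [p pE] := free_module_projective (h \o @free_cover R X : {linear _ -> _}) gS.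
have [|f fE] := linear_factor_inj iI
    (h := p \o @ker_val _ _ _ (@free_cover R X) : {linear _ -> _}).
  by move=> z; apply/ig; rewrite /= pE /= ker_valP linear0.
have [q qE] := ext f.
have [|p' p'E] := @linear_bundle _ _ _ (fun x => p x - i (q x)).
  by move=> a x y; rewrite !linearP /= scalerDr addrACA.
have [x /kernel_lift[z <-]|k kE] := linear_factor_surj (h := p') (@free_cover_surj X).
  by rewrite p'E qE fE subrr.
exists k => x; have [y <-] := free_cover_surj x.
rewrite kE p'E linearB /= pE /=.
have -> : g (i (q y)) = 0 by apply/ig; exists (q y).
by rewrite subr0.
Qed.

(** A piece of the long exact sequence: Ext^1(X, N) lies between Ext^1(X, B0) and Ext^2(X, B1), the
    latter written as Ext^1 of the first syzygy of [X]. *)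
Lemma Ext1_zero_shift X N (B0 B1 : lmodType R) (i : {linear B1 -> B0})
    (g : {linear B0 -> N}) :
    injective i -> exact_at i g -> (forall y, exists x, g x = y) ->
    Ext1_zero X B0 -> lifts (kernel (@free_cover R X)) B1 ->
  Ext1_zero X N.
Proof.
move=> iI ig gS ext lift f; have [h hE] := lift _ _ i g iI ig gS f.
have [k kE] := ext h.
by exists (g \o k : {linear _ -> _}) => z; rewrite /= kE hE.
Qed.

Lemma lifts_copower X N (I : Type) : lifts X N -> lifts (copower X I) N.
Proof.
move=> lift E F i g iI ig gS h.
have /choice[k kE] (j : I) : exists k : {linear X -> E},
    forall x, g (k x) = h (copower_inj X j x).
  exact: (lift _ _ i g iI ig gS (h \o copower_inj X j : {linear _ -> _})).
have [l lE] := copower_universal k; exists l => x.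
elim/copower_ind: x => [|x y gx gy|j x]; rewrite ?linear0 ?linearD //=.
  by rewrite gx gy.
by rewrite lE kE.
Qed.

Lemma lifts_retract X X' N : retract X X' -> lifts X' N -> lifts X N.
Proof.
move=> [j [r rj]] lift E F i g iI ig gS h.
have [k kE] := lift _ _ i g iI ig gS (h \o r : {linear _ -> _}).
by exists (k \o j : {linear _ -> _}) => x; rewrite /= kE /= rj.
Qed.

End Lifting.

(** * Extended naturals and resolutions of length at most 1 *)

Section ExtendedNaturals.
Implicit Type P : nat -> Prop.

Lemma least_le P n : le_enat (least P) (Some n) <-> exists2 m, (m <= n)%N & P m.
Proof.
rewrite /least; case: pselect => [exP|nP] /=.
  case: ex_minnP => k /asboolP Pk kmin; split=> [kn|[m mn Pm]]; first by exists k.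
  by apply: leq_trans mn; apply: kmin; apply/asboolP.
by split=> // -[m _ Pm]; case: nP; exists m; apply/asboolP.
Qed.

Lemma le_enat_trans n m x : le_enat x (Some n) -> (n <= m)%N -> le_enat x (Some m).
Proof. by case: x => //= k; exact: leq_trans. Qed.

Lemma le_enat0 x : x = Some 0%N <-> le_enat x (Some 0%N).
Proof. by case: x => [[|k]|]. Qed.

End ExtendedNaturals.

Section GlobalDimension.
Variables (R : pzRingType) (C : lmodType R).
Implicit Types M N A : lmodType R.

Lemma lAdd_gldim_le (Z : lmodType R -> Prop) n :
  le_enat (lAdd_gldim C Z) (Some n) <->
  forall M, Z M -> exists2 m, (m <= n)%N & left_Add_res C m M.
Proof.
split=> [/least_le[k kn Zk] M ZM|Zn].
  by apply/least_le; exact: le_enat_trans (Zk M ZM) kn.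
by apply/least_le; exists n => // M /Zn/least_le.
Qed.

(** Treats lengths 0 and 1 together: [A 2] is zero, so [d 0] is injective, and for [m = 0] the term
    [A 1] is zero, hence in Add(C). *)
Lemma left_Add_res_le1 M m : (m <= 1)%N -> left_Add_res C m M ->
  exists (A1 A0 : lmodType R) (i : {linear A1 -> A0}) (e : {linear A0 -> M}),
    [/\ in_Add C A1, in_Add C A0, injective i, exact_at i e &
        forall y, exists x, e x = y].
Proof.
move=> m1 [A [d [e [AddA A0 dd de eS]]]].
exists (A 1%N), (A 0%N), (d 0%N), e; split=> //; last 1 first.
- apply: raddf_inj => x /dd[z <-].
  by have -> : z = 0 by [apply: A0; exact: leq_ltn_trans m1 _]; rewrite linear0.
- have [m0|] := ltnP m 1; first by apply: in_Add_trivial; exact: A0.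
  exact: AddA.
- exact: AddA.
Qed.

(** Serves both lengths: for [m = 0] the term [A1] lies beyond the length and must vanish. The zero
    module [copower C void] fills the remaining degrees. *)
Lemma left_Add_res_intro m M (A1 A0 : lmodType R) (i : {linear A1 -> A0})
    (e : {linear A0 -> M}) :
    m = 1%N \/ m = 0%N /\ (forall x : A1, x = 0) ->
    in_Add C A1 -> in_Add C A0 -> injective i -> exact_at i e ->
    (forall y, exists x, e x = y) ->
  left_Add_res C m M.
Proof.
move=> mA1 AddA1 AddA0 iI ie eS.
pose Z : lmodType R := copower C void.
have Z0 (x : Z) : x = 0 by apply: dsumP => -[].
pose A n := match n with 0 => A0 | 1 => A1 | _ => Z end.
pose d n : {linear A n.+1 -> A n} :=
  match n return {linear A n.+1 -> A n} with 0 => i | _ => \0 end.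
exists A, d, e; split=> // [[|[|n]] _|[|[|n]]|[|n]] //.
- exact: in_Add_copower.
- by case: mA1 => [->|[-> ]].
- move=> x; split=> [ix|[z <-]]; last by rewrite /= linear0.
  by exists 0; apply: iI; rewrite linear0.
- by move=> x; split=> // _; exists 0; rewrite [RHS]Z0.
Qed.

End GlobalDimension.

(** * The category sigma[C] *)

Section SigmaCategory.
Variables (R : pzRingType) (C : lmodType R).
Implicit Types M N : lmodType R.

Lemma ker_val_exact M N (f : {linear M -> N}) : exact_at (@ker_val _ _ _ f) f.
Proof.
by move=> x; split=> [/kernel_lift|[y <-]]; [|exact: ker_valP].
Qed.

Lemma generated_of_surj (I : Type) N (g : {linear copower C I -> N}) :
  (forall y, exists x, g x = y) -> generated C N.
Proof.
move=> gS; exists I, (kernel g), (@ker_val _ _ _ g), g.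
by split=> //; [exact: ker_val_inj | exact: ker_val_exact].
Qed.

Lemma in_sigma_generated N : generated C N -> in_sigma C N.
Proof. by move=> gN; exists N => //; exists idfun. Qed.

Lemma in_sigma_sub (I : Type) N (f : {linear N -> copower C I}) :
  injective f -> in_sigma C N.
Proof.
move=> fI; exists (copower C I); last by exists f.
by apply: (@generated_of_surj I _ idfun) => y; exists y.
Qed.

(* [M] is the quotient of the preimage of [M] under a cover of [N] by copies of [C]. *)
Lemma in_sigma_subquotient M : in_sigma C M ->
  exists (I : Type) (A1 A0 : lmodType R) (i : {linear A1 -> A0})
      (e : {linear A0 -> M}) (j : {linear A0 -> copower C I}),
    [/\ injective i, exact_at i e, forall y, exists x, e x = y & injective j].
Proof.
move=> [N [I [K [k [g [_ _ gS]]]]] [f fI]].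
have [Q [q [qS qf]]] := quotient_exists (submod_range f).1 (submod_range f).2.
pose A0 : lmodType R := kernel (q \o g : {linear copower C I -> Q}).
pose j : {linear A0 -> copower C I} := @ker_val _ _ _ (q \o g : {linear _ -> _}).
have [|e eE] := linear_factor_inj fI (h := g \o j : {linear _ -> _}).
  by move=> x; apply/qf; exact: ker_valP x.
exists I, (kernel e), A0, (@ker_val _ _ _ e), e, j.
split; [exact: ker_val_inj | exact: ker_val_exact | | exact: ker_val_inj].
move=> y; have [d dE] := gS (f y).
have [|x xE] := @kernel_lift _ _ _ (q \o g : {linear copower C I -> Q}) d.
  by rewrite /= dE; apply/qf; exists y.
by exists x; apply: fI; rewrite eE /= -dE -xE.
Qed.

Hypothesis hC : Sigma_self_orthogonal C.

Lemma Ext1_zero_Add N : in_Add C N -> Ext1_zero C N.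
Proof.
move=> /in_AddP[I NI]; apply: Ext1_zero_retract NI _.
by apply: Ext_zero_1; exact: hC.
Qed.

(* Ext^1(syzygy C 1, N) is Ext^2(C, N). *)
Lemma Ext1_zero_syzygy_Add N : in_Add C N -> Ext1_zero (syzygy C 1) N.
Proof.
move=> /in_AddP[I NI]; apply: Ext1_zero_retract NI _.
by apply: Ext_zero_1; exact: (hC (i := 2)).
Qed.

Lemma lifts_Add A N : in_Add C A -> Ext1_zero C N -> lifts A N.
Proof.
move=> /in_AddP[I AI] ext; apply: lifts_retract AI _.
by apply: lifts_copower; exact: Ext1_zero_lifts.
Qed.

Lemma Ext1_zero_coresolved N (B1 B0 : lmodType R) (i : {linear B1 -> B0})
    (g : {linear B0 -> N}) :
    in_Add C B1 -> in_Add C B0 -> injective i -> exact_at i g ->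
    (forall y, exists x, g x = y) ->
  Ext1_zero C N.
Proof.
move=> AddB1 AddB0 iI ig gS; apply: (Ext1_zero_shift iI ig gS).
  exact: Ext1_zero_Add.
exact: Ext1_zero_lifts (Ext1_zero_syzygy_Add AddB1).
Qed.

Lemma split_of_gldim0 :
  (forall M, in_sigma C M -> in_Add C M) -> split_module C.
Proof.
move=> sigmaAdd K [K0 KP].
have [Q [q [qS qK]]] := quotient_exists K0 KP.
have [f fE] := copower_universal (fun _ : unit => idfun : {linear C -> C}).
have fS y : exists x, f x = y by exists (copower_inj C tt y); rewrite fE.
have sQ : in_sigma C Q.
  apply/in_sigma_generated/(@generated_of_surj unit _ (q \o f : {linear _ -> _})).
  by move=> y; have [x <-] := qS y; have [z <-] := fS x; exists z.
have sK : in_sigma C (kernel q).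
  have inj : injective (copower_inj C tt) by exact: can_inj (fE tt).
  apply: (@in_sigma_sub unit _ (copower_inj C tt
    \o @ker_val _ _ _ q : {linear _ -> _})).
  by move=> x y /inj /ker_val_inj.
(* The identity of [Q] lifts to a section [k] of [q], and [x |-> x - k (q x)] is the projection onto
   [K]. *)
have [k kE] := lifts_Add (sigmaAdd _ sQ) (Ext1_zero_Add (sigmaAdd _ sK))
  (@ker_val_inj _ _ _ q) (@ker_val_exact _ _ q) qS idfun.
have [|p pE] := @linear_bundle R C C (fun x => x - k (q x)).
  by move=> a x y; rewrite !linearP /= scalerDr addrACA.
exists p; split=> x; rewrite pE; first by apply/qK; rewrite linearB /= kE subrr.
by move/qK->; rewrite linear0 subr0.
Qed.

Lemma in_Add_submodule (A N : lmodType R) (f : {linear N -> A}) :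
    (forall M, in_sigma C M -> exists2 m, (m <= 1)%N & left_Add_res C m M) ->
  in_Add C A -> injective f -> in_Add C N.
Proof.
move=> gldim1 /in_AddP[I [u [v vu]]] fI.
pose D := copower C I.
pose j : {linear N -> D} := u \o f.
have jI : injective j by apply: inj_comp fI; exact: can_inj vu.
have [Q [q [qS qj]]] := quotient_exists (submod_range j).1 (submod_range j).2.
have jq : exact_at j q by move=> y; exact: qj.
have [m1 m1le /(left_Add_res_le1 m1le)[A1 [A0 [a [e [AddA1 AddA0 aI ae eS]]]]]] :=
  gldim1 Q (in_sigma_generated (generated_of_surj qS)).
(* The bound is used a second time, on [N] itself: it gives Ext^1(C, N) = 0, which allows lifting
   along [q], whose kernel is [N]. *)
have [m2 m2le /(left_Add_res_le1 m2le)[B1 [B0 [b [c [AddB1 AddB0 bI bc cS]]]]]] :=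
  gldim1 N (in_sigma_sub jI).
have extN := Ext1_zero_coresolved AddB1 AddB0 bI bc cS.
have AddD : in_Add C D := in_Add_copower C I.
have [h hE] := lifts_Add AddD (Ext1_zero_Add AddA1) aI ae eS q.
have [t tE] := lifts_Add AddA0 extN jI jq qS e.
(* [h] sends [N] into the kernel of [e], that is into [A1]. The sign in the section
   [x |-> (- l x, j x)] cancels [h (j x)] in the argument of [t]. *)
have [|l lE] := linear_factor_inj aI (h := h \o j : {linear _ -> _}).
  by move=> x; apply/ae; rewrite /= hE; apply/jq; exists x.
have [|s sE] := @linear_bundle R N (A1 * D)%type (fun x => (- l x, j x)).
  by move=> k x y; rewrite /= !linearP.
have [|r' r'E] := @linear_bundle R (A1 * D)%type D (fun x => x.2 - t (a x.1 + h x.2)).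
  move=> k x y; rewrite /= [a _]linearP [h _]linearP addrACA -scalerDr linearP /=.
  by rewrite scalerBr opprD addrACA.
(* The values of [r'] lie in [N]: [q] takes [t (a x.1 + h x.2)] to [e (a x.1) + e (h x.2)], which is
   [q x.2]. *)
have [|r rE] := linear_factor_inj jI (h := r').
  move=> x; apply/jq; rewrite r'E linearB /= tE linearD /= hE.
  by rewrite (_ : e (a _) = 0) ?add0r ?subrr //; apply/ae; eexists.
apply: in_Add_retract (in_Add_prod AddA1 AddD).
exists s, r => x; apply: jI.
by rewrite rE r'E sE /= linearN /= lE addNr linear0 subr0.
Qed.

End SigmaCategory.


(** * Semisimple [C] and dimension zero *)

Section Semisimplicity.
Variables (R : pzRingType) (C : lmodType R).

(** The copower is a quotient of the sum of the simple modules [S k.2] over pairs [k] in [L * I],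
    and splitting passes to quotients. *)
Lemma semisimple_copower_split (L : Type) :
  semisimple_module C -> split_module (copower C L).
Proof.
move=> [I [S [simpleS /lmod_iso_sym[f [f' _ f'K]]]]].
pose S' (k : L * I) := S k.2.
have [g gE] := @dsum_universal R _ S' (copower C L) (fun k =>
  copower_inj C k.1 \o f \o (@dsum_inj R I S k.2 : {linear S k.2 -> dsum S})).
apply: (@split_quotient _ (dsum S') _ g); last first.
  by apply: simple_dsum_split => k; exact: simpleS.
apply: copower_ind => [|_ _ [x <-] [y <-]|l c].
- by exists 0; rewrite linear0.
- by exists (x + y); rewrite linearD.
rewrite -(f'K c); elim/dsum_ind: (f' c) => [|x y [x' xE] [y' yE]|i v].
- by exists 0; rewrite !linear0.
- by exists (x' + y'); rewrite !linearD xE yE.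
by exists (@dsum_inj R _ S' (l, i) v); rewrite gE.
Qed.

(** Both steps leading from [copower C L] to [M], a quotient and then a submodule, are retracts
    because the modules involved split. *)
Lemma semisimple_in_Add M : semisimple_module C -> in_sigma C M -> in_Add C M.
Proof.
move=> ssC [N [L [K [_ [g [_ _ gS]]]]] [f fI]].
have sL := @semisimple_copower_split L ssC.
apply/in_AddP; exists L; apply: retract_trans (split_quotient_retract gS sL).
exact: split_sub_retract fI (split_quotient gS sL).
Qed.

Lemma left_Add_res0 M : left_Add_res C 0 M <-> in_Add C M.
Proof.
split=> [[A [d [e [AddA A0 dd de eS]]]]|AddM].
  have [|_ MA] := @iso_retract _ (A 0%N) M.
    apply: lmod_iso_bij eS; apply: raddf_inj => x /de[z <-].
    by have -> : z = 0 by [exact: A0]; rewrite linear0.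
  exact: in_Add_retract MA (AddA 0%N _).
have Z0 (x : copower C void) : x = 0 by apply: dsumP => -[].
apply: (@left_Add_res_intro _ _ 0 M (copower C void) M \0 idfun) => //.
- by right.
- exact: in_Add_copower.
- by move=> x y _; rewrite (Z0 x) (Z0 y).
- by move=> x; split=> /= [->|[y <-]//]; exists 0.
- by move=> y; exists y.
Qed.

End Semisimplicity.

Theorem proposition4p6 (R : pzRingType) (C : lmodType R)
    (hC : Sigma_self_orthogonal C) :
  (lAdd_gldim C (in_sigma C) = Some 0%N <-> semisimple_module C) /\
  (le_enat (lAdd_gldim C (in_sigma C)) (Some 1%N) <->
     Add_closed_under_submodules C).
Proof.
rewrite le_enat0 !lAdd_gldim_le; split; split=> [gldim|].
- apply/split_semisimple/(split_of_gldim0 hC) => M /gldim[m].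
  by rewrite leqn0 => /eqP-> /left_Add_res0.
- by move=> ssC M /(semisimple_in_Add ssC) AddM; exists 0%N => //; apply/left_Add_res0.
- by move=> A N AddA [f fI]; exact: (in_Add_submodule hC gldim AddA fI).
move=> subAdd M /in_sigma_subquotient[I [A1 [A0 [i [e [j [iI ie eS jI]]]]]]].
have AddD := in_Add_copower C I.
exists 1%N => //; apply: (left_Add_res_intro _ _ _ iI ie eS); first by left.
  by apply: subAdd AddD _; exists (j \o i); exact: (inj_comp jI iI).
by apply: subAdd AddD _; exists j.
Qed.
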